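(* Let $n\ge1$ and $Y_1,\dots,Y_n\in[0,1]$, with order statistics $Y_{(0)}\le Y_{(1)}\le\cdots\le Y_{(n-1)}$. Then $$n\,\bar\omega^2_1=\frac{1}{12n}+\sum_{i=0}^{n-1}\left(\frac{2i+1}{2n}-Y_{(i)}\right)^2 .$$
   Context: The statistic $\bar\omega^2_1$ is the average of two corner functionals on $[0,1]$: $\bar\omega^2_1=\frac12\left(\omega^2_{\mathrm{low}}+\omega^2_{\mathrm{high}}\right)$, where $\omega^2_{\mathrm{low}}=\int_0^1\left(\frac1n\sum_{i=1}^n\mathbf 1\{Y_i\le x\}-x\right)^2dx$ and $\omega^2_{\mathrm{high}}=\int_0^1\left(\frac1n\sum_{i=1}^n\mathbf 1\{Y_i\ge x\}-(1-x)\right)^2dx$. The order statistics are the sample values rearranged in nondecreasing order, indexed from $0$ to $n-1$. *)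

(* Defs.v *)
From mathcomp Require Import all_boot all_order all_algebra.
From mathcomp Require Import all_classical all_reals all_analysis.

Set Implicit Arguments.
Unset Strict Implicit.
Unset Printing Implicit Defensive.

Import Order.TTheory GRing.Theory Num.Theory.

Local Open Scope classical_set_scope.
Local Open Scope ring_scope.

(* A sample Y_1, ..., Y_n is a function Y : 'I_n -> R; the booleans
   (Y i <= x) and (x <= Y i) are cast to 0 or 1 by %:R. *)

Definition omega2_low (R : realType) (n : nat) (Y : 'I_n -> R) : R :=
  \int[lebesgue_measure]_(x in `[0, 1])
    (n%:R^-1 * (\sum_(i < n) (Y i <= x)%R%:R) - x) ^+ 2.

Definition omega2_high (R : realType) (n : nat) (Y : 'I_n -> R) : R :=
  \int[lebesgue_measure]_(x in `[0, 1])
    (n%:R^-1 * (\sum_(i < n) (x <= Y i)%R%:R) - (1 - x)) ^+ 2.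

Definition omega2_bar1 (R : realType) (n : nat) (Y : 'I_n -> R) : R :=
  2^-1 * (omega2_low Y + omega2_high Y).

(* The default value 0 of nth is never used, since i < n. *)
Definition order_stat (R : realType) (n : nat) (Y : 'I_n -> R) (i : 'I_n) : R :=
  nth 0 (sort <=%R (codom Y)) i.

(* Main.v *)
(** Expand the square of the empirical distribution function minus [x] and
    integrate termwise: the double sum of [1{Y_i <= x} 1{Y_j <= x}] integrates to
    the sum of [1 - max (Y_i, Y_j)].  The upper corner gives [min (Y_i, Y_j)]
    instead and, since [min + max] is the sum of its arguments, both corners
    equal [1/3 + (sum Y_i^2) / n - (sum max (Y_i, Y_j)) / n^2].  In sorted order,
    [Y_(k)] is the maximum of exactly [2k + 1] pairs, so the double sum of maxima
    is [sum (2k + 1) Y_(k)], and completing the squares concludes. *)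
Require Import Defs.
From mathcomp Require Import all_boot all_order all_algebra.
From mathcomp Require Import all_classical all_reals all_analysis.
From mathcomp Require Import ring.

Import Order.TTheory GRing.Theory Num.Theory.
Import numFieldNormedType.Exports.

Local Open Scope ring_scope.

(** Linearity of the integral asks for integrability of each summand; pairing integrability with the
    value lets both pass through sums and scalings together. *)
Definition has_integral01 {R : realType} (f : R -> R) (v : R) :=
  (@lebesgue_measure R).-integrable `[0, 1]%classic (EFin \o f) /\
  \int[lebesgue_measure]_(x in `[0, 1]%classic) f x = v.

Lemma eq_has_integral01 {R : realType} (f g : R -> R) (v : R) :
  (forall x, 0 <= x <= 1 -> f x = g x) ->
  has_integral01 f v -> has_integral01 g v.
Proof.
move=> fg [intf <-]; split.
  apply: eq_integrable intf => //= x; rewrite inE/= in_itv/= => x01.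
  by rewrite fg.
by apply: eq_Rintegral => x; rewrite inE/= in_itv/= => x01; rewrite fg.
Qed.

Lemma has_integral01D {R : realType} {f g : R -> R} {v w : R} :
  has_integral01 f v -> has_integral01 g w ->
  has_integral01 (fun x => f x + g x) (v + w).
Proof.
move=> [intf <-] [intg <-]; split; last exact: RintegralD.
exact: (integrableD _ intf intg).
Qed.

Lemma has_integral01Z {R : realType} (c : R) (f : R -> R) (v : R) :
  has_integral01 f v -> has_integral01 (fun x => c * f x) (c * v).
Proof.
move=> [intf <-]; split; last exact: RintegralZl.
exact: (integrableZl _ c intf).
Qed.

Lemma has_integral01_sum {R : realType} {n : nat} (f : 'I_n -> R -> R)
    (v : 'I_n -> R) :
  (forall i, has_integral01 (f i) (v i)) ->
  has_integral01 (fun x => \sum_(i < n) f i x) (\sum_(i < n) v i).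
Proof.
elim: n f v => [|n IHn] f v fv.
  rewrite big_ord0; apply: (eq_has_integral01 (fun=> 0)).
    by move=> x _; rewrite big_ord0.
  split; first exact: integrable0.
  by rewrite /Rintegral integral0.
rewrite big_ord_recr/=.
apply: (eq_has_integral01 (fun x =>
    \sum_(i < n) f (widen_ord (leqnSn n) i) x + f ord_max x)).
  by move=> x _; rewrite big_ord_recr.
by apply: has_integral01D (fv _); exact: IHn.
Qed.

Lemma Rintegral_deriv_horner {R : realType} (p : {poly R}) (a b : R) : a <= b ->
  \int[lebesgue_measure]_(x in `[a, b]%classic) p^`().[x] = p.[b] - p.[a].
Proof.
(* The fundamental theorem asks for [a < b]; the case [a = b] does arise, for instance when a sample
   value is an endpoint of [[0, 1]]. *)
rewrite le_eqVlt => /predU1P[<-|ab].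
  by rewrite set_itv1 Rintegral_set1 subrr.
rewrite /Rintegral (@continuous_FTC2 _ _ (horner p)) //.
- by apply: continuous_subspaceT; exact: continuous_horner.
- split=> [x _||]; first exact: derivable_horner.
  + by apply: cvg_at_right_filter; exact: continuous_horner.
  + by apply: cvg_at_left_filter; exact: continuous_horner.
- by move=> x _; rewrite -derivE.
Qed.

(** The indicator restricts a continuous function to a segment inside [[0, 1]]. Each term of the
    expanded square has this shape. *)
Lemma has_integral01_itv {R : realType} (p : {poly R}) (a b : R) :
  0 <= a -> a <= b -> b <= 1 ->
  has_integral01 (fun x => (a <= x <= b)%R%:R * p^`().[x]) (p.[b] - p.[a]).
Proof.
move=> a0 ab b1.
have sub : (`[0, 1] `&` `[a, b] = `[a, b] :> set R)%classic.
  apply/seteqP; split=> x /=; first by case.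
  rewrite !in_itv/= => /andP[ax xb]; split; last exact/andP.
  by rewrite (le_trans a0 ax) (le_trans xb b1).
have E : (fun x => (a <= x <= b)%R%:R * p^`().[x]) =
    (horner p^`() \_ `[a, b]%classic) :> (R -> R).
  apply/funext => x; rewrite patchE mem_setE/= in_itv/=.
  by case: ifP => _; rewrite ?mul1r ?mul0r.
rewrite E; split; last first.
  by rewrite -Rintegral_mkcondr sub Rintegral_deriv_horner.
rewrite -restrict_EFin; apply/integrable_restrict => //.
rewrite sub; apply: continuous_compact_integrable.
  exact: segment_compact.
by apply: continuous_subspaceT; exact: continuous_horner.
Qed.

(* [L] and [Q] stand for antiderivatives of the reference function and of its
   square; [a = Y, b = 1] is the lower corner and [a = 0, b = Y] the upper one. *)
Lemma Rintegral_sqr_step {R : realType} {n : nat} (a b : 'I_n -> R) (c : R)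
    (L Q : {poly R}) :
  (forall i, 0 <= a i) -> (forall i, b i <= 1) ->
  (forall i j, a i <= b j) -> Q^`() = L^`() ^+ 2 ->
  \int[lebesgue_measure]_(x in `[0, 1]%classic)
    (c * \sum_(i < n) (a i <= x <= b i)%R%:R - L^`().[x]) ^+ 2 =
  c ^+ 2 * \sum_(i < n) \sum_(j < n)
     (Num.min (b i) (b j) - Num.max (a i) (a j))
  - 2 * c * \sum_(i < n) (L.[b i] - L.[a i]) + (Q.[1] - Q.[0]).
Proof.
move=> a0 b1 ab QL.
set T1 := c ^+ 2 * _; set T2 := 2 * c * _; rewrite -mulNr.
suff [] : has_integral01 (fun x =>
    (c * \sum_(i < n) (a i <= x <= b i)%R%:R - L^`().[x]) ^+ 2)
    (T1 + - (2 * c) * (\sum_(i < n) (L.[b i] - L.[a i])) + (Q.[1] - Q.[0])) by [].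
(* A product of two interval indicators is the indicator of the intersection, from the larger left
   end to the smaller right end. The derivative of ['X] is the constant 1, and [0 <= x <= 1] holds
   on the whole domain. *)
apply: (eq_has_integral01 (fun x =>
    c ^+ 2 * (\sum_(i < n) \sum_(j < n)
      (Num.max (a i) (a j) <= x <= Num.min (b i) (b j))%R%:R *
        ('X : {poly R})^`().[x])
    + - (2 * c) * (\sum_(i < n) (a i <= x <= b i)%R%:R * L^`().[x])
    + (0 <= x <= 1)%R%:R * Q^`().[x])).
  move=> x ->; rewrite QL !hornerE derivX hornerC.
  rewrite -mulr_suml.
  under eq_bigr => i _.
    under eq_bigr => j _.
      rewrite mulr1 ge_max le_min andbACA -mulnb natrM; over.
    rewrite -mulr_sumr; over.
  rewrite -mulr_suml; ring.
apply: has_integral01D; first apply: has_integral01D.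
- apply: has_integral01Z; apply: has_integral01_sum => i.
  apply: has_integral01_sum => j.
  rewrite -[X in X - _]hornerX -[X in _ - X]hornerX.
  apply: has_integral01_itv.
  + by rewrite le_max a0.
  (* Any two of the intervals meet, since every left end lies below every right end. *)
  + by rewrite ge_max !le_min !ab.
  + by rewrite ge_min b1.
- apply: has_integral01Z; apply: has_integral01_sum => i.
  exact: has_integral01_itv.
- exact: has_integral01_itv.
Qed.

(** Induction on the table of maxima: the new largest value [u n] fills a row and a column of [n]
    entries each, plus the corner. *)
Lemma sum_max_nondecreasing {R : realDomainType} {n : nat} (u : nat -> R) :
  (forall i j, (i <= j)%N -> (j < n)%N -> u i <= u j) ->
  \sum_(i < n) \sum_(j < n) Num.max (u i) (u j) =
  \sum_(i < n) (2 * i%:R + 1) * u i.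
Proof.
elim: n => [|n IHn] u_nd; first by rewrite !big_ord0.
rewrite !big_ord_recr/= maxxx -IHn; last first.
  by move=> i j ij jn; apply: u_nd => //; exact: ltnW.
under eq_bigr do rewrite big_ord_recr/=.
rewrite big_split/=.
rewrite [X in _ + X + _ = _](eq_bigr (fun=> u n)); last first.
  by move=> i _; rewrite max_r// u_nd// ltnW.
rewrite [X in _ + (X + _) = _](eq_bigr (fun=> u n)); last first.
  by move=> i _; rewrite max_l// u_nd// ltnW.
rewrite sumr_const card_ord -mulr_natl; ring.
Qed.

Lemma sum_order_stat {R : realType} {n : nat} (Y : 'I_n -> R) (F : R -> R) :
  \sum_(i < n) F (order_stat Y i) = \sum_(i < n) F (Y i).
Proof.
have szs : size (sort <=%R (codom Y)) = n.
  by rewrite size_sort size_codom card_ord.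
transitivity (\sum_(y <- sort <=%R (codom Y)) F y).
  by rewrite (big_nth 0) szs big_mkord.
by rewrite (perm_big _ (permEl (perm_sort _ _))) big_image.
Qed.

Lemma sum_max_order_stat {R : realType} {n : nat} (Y : 'I_n -> R) :
  \sum_(i < n) \sum_(j < n) Num.max (Y i) (Y j) =
  \sum_(i < n) (2 * i%:R + 1) * order_stat Y i.
Proof.
(* Sorting permutes the sample, so each index of the double sum can be rearranged in turn. *)
rewrite -(sum_order_stat Y (fun y => \sum_(j < n) Num.max y (Y j))).
under eq_bigr do rewrite -(sum_order_stat Y (fun y => Num.max _ y)).
rewrite -(sum_max_nondecreasing (nth 0 (sort <=%R (codom Y)))) // => i j ij jn.
apply: (sorted_leq_nth le_trans lexx) => //; first exact: sort_le_sorted.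
all: by rewrite inE size_sort size_codom card_ord // (leq_ltn_trans ij).
Qed.

Lemma sum_min_sum_max {R : realType} {n : nat} (Y : 'I_n -> R) :
  \sum_(i < n) \sum_(j < n) Num.min (Y i) (Y j) =
  2 * n%:R * (\sum_(i < n) Y i) - \sum_(i < n) \sum_(j < n) Num.max (Y i) (Y j).
Proof.
apply/eqP; rewrite eq_sym subr_eq eq_sym -big_split/=; apply/eqP.
under eq_bigr do rewrite -big_split/=.
under eq_bigr => i _ do under eq_bigr do rewrite addr_min_max.
under eq_bigr do rewrite big_split/= sumr_const card_ord -mulr_natl.
by rewrite big_split/= -mulr_sumr sumr_const card_ord -[in RHS]mulr_natl; ring.
Qed.

(** The factor 3 clears the denominator, so the induction needs only ring identities. *)
Lemma sum_sqr_odd (R : comPzRingType) (n : nat) :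
  3 * \sum_(i < n) (2 * i%:R + 1) ^+ 2 = 4 * n%:R ^+ 3 - n%:R :> R.
Proof.
elim: n => [|n IHn]; first by rewrite big_ord0; ring.
by rewrite big_ord_recr/= mulrDr IHn -natr1; ring.
Qed.

Lemma omega2_lowE {R : realType} {n : nat} (Y : 'I_n -> R) :
  (0 < n)%N -> (forall i, 0 <= Y i <= 1) ->
  omega2_low Y = 3^-1 + n%:R^-1 * \sum_(i < n) Y i ^+ 2
    - n%:R^-1 ^+ 2 * \sum_(i < n) \sum_(j < n) Num.max (Y i) (Y j).
Proof.
move=> n0 Y01; pose L : {poly R} := 2^-1 *: 'X^2; pose Q : {poly R} := 3^-1 *: 'X^3.
have LE : L^`() = 'X.
  rewrite /L derivZ derivXn -['X^_ *+ 2]scaler_nat scalerA.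
  by rewrite mulVf ?scale1r// pnatr_eq0.
have QE : Q^`() = L^`() ^+ 2.
  rewrite LE /Q derivZ derivXn -['X^_ *+ 3]scaler_nat scalerA.
  by rewrite mulVf ?scale1r// pnatr_eq0.
have nN0 : n%:R != 0 :> R by rewrite pnatr_eq0 -lt0n.
(* On the domain [x <= 1], so the constant right end 1 leaves each indicator unchanged. *)
transitivity (\int[lebesgue_measure]_(x in `[0, 1]%classic)
    (n%:R^-1 * \sum_(i < n) (Y i <= x <= (fun=> 1 : R) i)%R%:R - L^`().[x]) ^+ 2).
  apply: eq_Rintegral => x; rewrite inE/= in_itv/= => /andP[_ x1].
  rewrite LE hornerX; congr ((_ * _ - _) ^+ 2).
  by apply: eq_bigr => i _; rewrite x1 andbT.
rewrite (Rintegral_sqr_step Y (fun=> 1) _ L Q) //; last first.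
- by move=> i _; have /andP[] := Y01 i.
- by move=> i; have /andP[] := Y01 i.
under eq_bigr do under eq_bigr do rewrite minxx.
under eq_bigr do rewrite sumrB sumr_const card_ord.
rewrite sumrB sumr_const card_ord.
have LY : \sum_(i < n) (L.[1] - L.[Y i]) = 2^-1 * (n%:R - \sum_(i < n) Y i ^+ 2).
  under eq_bigr do rewrite /L !hornerZ !hornerXn expr1n -mulrBr.
  by rewrite -mulr_sumr sumrB sumr_const card_ord.
have QB : Q.[1] - Q.[0] = 3^-1 by rewrite /Q !hornerZ !hornerXn; ring.
(* The 1 from the [n ^ 2] pairs cancels the -1 from the cross term. *)
by rewrite LY QB -[n%:R *+ n]mulr_natl; field.
Qed.

Lemma omega2_highE {R : realType} {n : nat} (Y : 'I_n -> R) :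
  (0 < n)%N -> (forall i, 0 <= Y i <= 1) ->
  omega2_high Y = 3^-1 + n%:R^-1 * \sum_(i < n) Y i ^+ 2
    - n%:R^-1 ^+ 2 * \sum_(i < n) \sum_(j < n) Num.max (Y i) (Y j).
Proof.
move=> n0 Y01.
pose L : {poly R} := 'X - 2^-1 *: 'X^2.
pose Q : {poly R} := 'X - 'X^2 + 3^-1 *: 'X^3.
have LE : L^`() = 1 - 'X.
  rewrite /L derivB derivX derivZ !derivXn -['X^_ *+ 2]scaler_nat scalerA.
  by rewrite mulVf ?scale1r// pnatr_eq0.
have QE : Q^`() = L^`() ^+ 2.
  rewrite LE /Q derivD derivB derivX derivZ !derivXn -['X^_ *+ 3]scaler_nat scalerA.
  by rewrite mulVf ?scale1r ?pnatr_eq0//; ring.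
have nN0 : n%:R != 0 :> R by rewrite pnatr_eq0 -lt0n.
transitivity (\int[lebesgue_measure]_(x in `[0, 1]%classic)
    (n%:R^-1 * \sum_(i < n) ((fun=> 0 : R) i <= x <= Y i)%R%:R - L^`().[x]) ^+ 2).
  apply: eq_Rintegral => x; rewrite inE/= in_itv/= => /andP[x0 _].
  rewrite LE !hornerE; congr ((_ * _ - _) ^+ 2).
  by apply: eq_bigr => i _; rewrite x0.
rewrite (Rintegral_sqr_step (fun=> 0) Y _ L Q) //; last first.
- by move=> _ i; have /andP[] := Y01 i.
- by move=> i; have /andP[] := Y01 i.
under eq_bigr do under eq_bigr do rewrite maxxx subr0.
rewrite sum_min_sum_max.
have LY : \sum_(i < n) (L.[Y i] - L.[0]) =
    \sum_(i < n) Y i - 2^-1 * \sum_(i < n) Y i ^+ 2.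
  under eq_bigr do rewrite /L !(hornerD, hornerN, hornerZ, hornerX, hornerXn)
    expr0n mulr0 !subr0.
  by rewrite sumrB mulr_sumr.
have QB : Q.[1] - Q.[0] = 3^-1.
  by rewrite /Q !(hornerD, hornerN, hornerZ, hornerX, hornerXn); ring.
(* The linear terms [2 / n * sum Y_i] from the minima and from the cross term cancel. *)
by rewrite LY QB; field.
Qed.

Theorem corollary3p5 (R : realType) (n : nat) (Y : 'I_n -> R)
    (n_ge1 : (1 <= n)%N) (Y01 : forall i : 'I_n, 0 <= Y i <= 1) :
  n%:R * omega2_bar1 Y =
    1 / (12 * n%:R)
    + \sum_(i < n) ((2 * i%:R + 1) / (2 * n%:R) - order_stat Y i) ^+ 2.
Proof.
have nN0 : n%:R != 0 :> R by rewrite pnatr_eq0 -lt0n.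
rewrite /omega2_bar1 omega2_lowE// omega2_highE// sum_max_order_stat.
rewrite -(sum_order_stat Y (fun y => y ^+ 2)).
have odd2 := sum_sqr_odd R n.
have -> : \sum_(i < n) ((2 * i%:R + 1) / (2 * n%:R) - order_stat Y i) ^+ 2 =
    (2 * n%:R)^-1 ^+ 2 * (\sum_(i < n) (2 * i%:R + 1) ^+ 2)
    - n%:R^-1 * (\sum_(i < n) (2 * i%:R + 1) * order_stat Y i)
    + \sum_(i < n) order_stat Y i ^+ 2.
  rewrite !mulr_sumr -sumrB -big_split/=.
  by apply: eq_bigr => i _; field.
(* Divided by [4 n ^ 2], this sum is [n / 3 - 1 / (12 n)]: the summand [1 / (12 n)] of the theorem
   cancels the correction, leaving [n] times the constant [1 / 3] of the corners. *)
have -> : \sum_(i < n) (2 * i%:R + 1) ^+ 2 = 3^-1 * (4 * n%:R ^+ 3 - n%:R) :> R.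
  by rewrite -odd2; field.
by field.
Qed.
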